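(* Let $G$ be a topological group and $R$ a commutative ring. Then the $G$-cup length $\mathbf{cl}_G(-)=\mathbf{cl}_G(-;R)$ and the equivariant Lusternik--Schnirelmann category $\mathbf{cat}_G$, regarded as maps $$\mathbf{cl}_G,\ \mathbf{cat}_G\colon \mathrm{Ob}(\mathrm{Top}^G)\sqcup \mathrm{Mor}(\mathrm{Top}^G)\to \mathbb{N}\cup\{\infty\},$$ are $G$-categorical invariants.
   Context: $\mathrm{Top}^G$ is the category of topological spaces with $G$-action and $G$-equivariant maps ($G$-maps). $\mathbb N$ includes $0$. $G$-categorical invariant: a map $\mathbf I^G$ assigning to each object and each morphism of $\mathrm{Top}^G$ a value in a totally ordered set of values (here $\mathbb N\cup\{\infty\}$) such that (1) $\mathbf I^G(\mathrm{id}_X)=\mathbf I^G(X)$ for every object $X$; (2) for all composable $G$-maps $X\xrightarrow{f}Y\xrightarrow{g}Z\xrightarrow{h}W$ one has $\mathbf I^G(h\circ g\circ f)\le \mathbf I^G(g)$. Borel cohomology: $X_G^h:=EG\times_G X$, $H_G^*(X;R):=H^*(X_G^h;R)$; a $G$-map $f\colon X\to Y$ induces $f_G^h\colon X_G^h\to Y_G^h$ and hence $f_G^{h*}\colon H_G^*(Y;R)\to H_G^*(X;R)$. $\tilde H_G^*(X;R)$ denotes the positive-degree part of $H_G^*(X;R)$. For a subset $S$ of a cohomology ring, $\mathrm{nil}(S)$ is the largest $k\ge 0$ such that some product of $k$ elements of $S$ is non-zero ($\infty$ if there is no largest such $k$; $0$ if all elements of $S$ are zero). The $G$-cup length of a $G$-map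 $f\colon X\to Y$ is $\mathbf{cl}_G(f;R):=\mathrm{nil}\big(f_G^{h*}(\tilde H_G^*(Y;R))\big)$, and of a $G$-space is $\mathbf{cl}_G(X;R):=\mathrm{nil}(\tilde H_G^*(X;R))$. The equivariant LS category $\mathbf{cat}_G(f)$ of a $G$-map $f\colon X\to Y$ is the least integer $n\ge0$ such that $X$ has a cover by $n+1$ $G$-invariant open sets $U_0,\dots,U_n$ such that each $f|_{U_i}$ is $G$-homotopic to a $G$-map $U_i\to Y$ whose image lies in the orbit of some $y_i\in Y$ ($\infty$ if no such $n$). $\mathbf{cat}_G(X)$ is the least $n\ge0$ such that $X$ has a cover by $n+1$ $G$-invariant open sets, each of whose inclusions into $X$ is $G$-homotopic to a $G$-map with image in a single orbit ($\infty$ if no such $n$). *)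

(* Defs.v *)
From HB Require Import structures.
From mathcomp Require Import all_boot all_order all_algebra generic_quotient zify.
From mathcomp Require Import all_classical all_reals all_analysis.

Set Implicit Arguments.
Unset Strict Implicit.
Unset Printing Implicit Defensive.

Import Order.TTheory GRing.Theory Num.Theory.
Import numFieldNormedType.Exports.

Local Open Scope classical_set_scope.
Local Open Scope ring_scope.

(* The value set: the natural numbers with a top element Infty. *)
Variant enat := Fin of nat | Infty.

Section enat_order.

Definition option_of_enat (x : enat) := if x is Fin n then Some n else None.
Definition enat_of_option (o : option nat) := if o is Some n then Fin n else Infty.

Fact option_of_enatK : cancel option_of_enat enat_of_option.
Proof. by case. Qed.

HB.instance Definition _ := Countable.copy enat (can_type option_of_enatK).

Definition leen (x y : enat) : bool :=
  match x, y with
  | _, Infty => true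
  | Infty, Fin _ => false
  | Fin m, Fin n => (m <= n)%N
  end.

Fact leen_refl : reflexive leen.
Proof. by case=> //= n; exact: leqnn. Qed.

Fact leen_anti : antisymmetric leen.
Proof. by case=> [m|] [n|] //= /anti_leq ->. Qed.

Fact leen_trans : transitive leen.
Proof. by case=> [m|] [n|] [p|] //=; exact: leq_trans. Qed.

Fact enat_display : Order.disp_t. Proof. exact: Order.Disp tt tt. Qed.

HB.instance Definition _ :=
  Order.Le_isPOrder.Build enat_display enat leen_refl leen_anti leen_trans.

Fact leen_total : total (<=%O : rel enat).
Proof. by case=> [m|] [n|] //; exact: leq_total. Qed.

HB.instance Definition _ := Order.POrder_isTotal.Build enat_display enat leen_total.

End enat_order.

(* Infty when no natural number satisfies P. *)
Definition least (P : nat -> Prop) : enat :=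
  match pselect (exists n, P n /\ forall m, P m -> (n <= m)%N) with
  | left e => Fin (projT1 (cid e))
  | right _ => Infty
  end.

(* Infty when P has no largest element; in particular when P is empty. *)
Definition largest (P : nat -> Prop) : enat :=
  match pselect (exists n, P n /\ forall m, P m -> (m <= n)%N) with
  | left e => Fin (projT1 (cid e))
  | right _ => Infty
  end.

HB.mixin Record isTopologicalGroup G & Group G & Topological G := {
  mulg_continuous : continuous (fun p : G * G => (p.1 * p.2)%g);
  invg_continuous : continuous (fun x : G => x^-1%g);
}.

#[short(type="topGroupType")]
HB.structure Definition TopologicalGroup :=
  {G of Group G & Topological G & isTopologicalGroup G}.

Record GSpace (G : topGroupType) := MkGSpace {
  gspace_sort :> topologicalType;
  gact : G -> gspace_sort -> gspace_sort;
  gact1 : forall x, gact 1%g x = x;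
  gactM : forall g h x, gact (g * h)%g x = gact g (gact h x);
  gact_continuous :
    continuous (fun p : G * gspace_sort => gact p.1 p.2) }.

Record GMap (G : topGroupType) (X Y : GSpace G) := MkGMap {
  gmap_fun :> continuousType X Y;
  gmapE : forall g x, gmap_fun (gact g x) = gact g (gmap_fun x) }.

Section GMaps.
Context {G : topGroupType}.

Definition gid (X : GSpace G) : GMap X X :=
  @MkGMap G X X idfun (fun _ _ => erefl).

Fact gcomp_equivariant (X Y Z : GSpace G) (g : GMap Y Z) (f : GMap X Y) a x :
  (g \o f) (gact a x) = gact a ((g \o f) x).
Proof. by rewrite /= !gmapE. Qed.

Definition gcomp (X Y Z : GSpace G) (g : GMap Y Z) (f : GMap X Y) : GMap X Z :=
  @MkGMap G X Z (g \o f) (gcomp_equivariant g f).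

End GMaps.

Inductive ob_mor (G : topGroupType) : Type :=
| Ob of GSpace G
| Mor (X Y : GSpace G) of GMap X Y.
Arguments Ob {G} _.
Arguments Mor {G X Y} _.

Definition is_G_categorical_invariant (G : topGroupType)
    (d : Order.disp_t) (V : orderType d) (I : ob_mor G -> V) : Prop :=
  (forall X : GSpace G, I (Mor (gid X)) = I (Ob X)) /\
  (forall (X Y Z W : GSpace G) (f : GMap X Y) (g : GMap Y Z) (h : GMap Z W),
     (I (Mor (gcomp h (gcomp g f))) <= I (Mor g))%O).

Section category.
Variables (K : realType) (G : topGroupType).

Definition unit_interval : set K := `[0, 1].

Definition G_invariant (X : GSpace G) (U : set X) :=
  forall g x, U x -> U (gact g x).

Section subGSpace.
Variables (X : GSpace G) (U : set X) (invU : G_invariant U).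

Definition sub_gact (g : G) (u : U) : U :=
  exist _ (gact g (set_val u)) (mem_set (invU g (set_valP u))).

Fact sub_gact1 u : sub_gact 1%g u = u.
Proof. by apply: val_inj; exact: gact1. Qed.

Fact sub_gactM g h u : sub_gact (g * h)%g u = sub_gact g (sub_gact h u).
Proof. by apply: val_inj; exact: gactM. Qed.

Fact sub_gact_continuous : continuous (fun p : G * U => sub_gact p.1 p.2).
Proof.
apply: continuous_comp_initial.
pose h (p : G * U) : G * X := (p.1, set_val p.2).
have hc : continuous h.
  move=> p; apply: cvg_pair => /=; first exact: cvg_fst.
  apply: cvg_comp; first exact: cvg_snd.
  exact: initial_continuous.
move=> p; exact: (@continuous_comp _ _ _ h (fun q => gact q.1 q.2) p (hc p) (@gact_continuous G X _)).
Qed.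

Definition sub_GSpace : GSpace G :=
  MkGSpace sub_gact1 sub_gactM sub_gact_continuous.

Fact incl_continuous : continuous (set_val : U -> X).
Proof. exact: initial_continuous. Qed.

Definition incl : GMap sub_GSpace X :=
  @MkGMap G sub_GSpace X (mkcts incl_continuous) (fun _ _ => erefl).

End subGSpace.

(* H is equivariant for the trivial action on the interval. *)
Definition G_homotopic (X Y : GSpace G) (f0 f1 : GMap X Y) : Prop :=
  exists H : continuousType (X * unit_interval)%type Y,
    [/\ forall g x t, H (gact g x, t) = gact g (H (x, t)),
        forall x t, set_val t = 0 -> H (x, t) = f0 x &
        forall x t, set_val t = 1 -> H (x, t) = f1 x].

Definition orbit (X : GSpace G) (x : X) : set X := [set gact g x | g in setT].
Arguments orbit {X} x.

(* f is G-homotopic to a G-map with image in a single orbit of Y. *)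
Definition G_orbit_contractible (X Y : GSpace G) (f : GMap X Y) : Prop :=
  exists (y : Y) (c : GMap X Y), range c `<=` orbit y /\ G_homotopic f c.

Definition cat_cover_mor (X Y : GSpace G) (f : GMap X Y) (n : nat) : Prop :=
  exists (U : 'I_n.+1 -> set X) (invU : forall i, G_invariant (U i)),
    [/\ forall i, open (U i),
        \bigcup_i U i = setT &
        forall i, G_orbit_contractible (gcomp f (incl (invU i)))].

Definition cat_cover_ob (X : GSpace G) (n : nat) : Prop :=
  exists (U : 'I_n.+1 -> set X) (invU : forall i, G_invariant (U i)),
    [/\ forall i, open (U i),
        \bigcup_i U i = setT &
        forall i, G_orbit_contractible (incl (invU i))].

Definition cat_G (a : ob_mor G) : enat :=
  match a with
  | Ob X => least (cat_cover_ob X)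
  | Mor _ _ f => least (cat_cover_mor f)
  end.

End category.

Section simplices.
Variable K : realType.

Definition std_simplex (n : nat) : set 'rV[K]_n.+1 :=
  [set t | (forall i, 0 <= t 0 i) /\ \sum_i t 0 i = 1].
Arguments std_simplex n : clear implicits.

(* The affine map sending the i-th vertex to the (f i)-th vertex.  The default
   value of inord is irrelevant as long as f maps [0, m] into [0, n]. *)
Definition affine_row m n (f : nat -> nat) (t : 'rV[K]_m.+1) : 'rV[K]_n.+1 :=
  \row_j \sum_(i < m.+1 | inord (f i) == j) t 0 i.

Fact affine_row_simplex m n f (t : std_simplex m) :
  affine_row n f (set_val t) \in std_simplex n.
Proof.
have [t0 t1] := set_valP t; apply/mem_set; split=> [j|].
  by rewrite mxE; apply: sumr_ge0 => i _; exact: t0.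
under eq_bigr do rewrite mxE big_mkcond.
rewrite exchange_big /= -{}[RHS]t1; apply: eq_bigr => i _.
by rewrite -big_mkcond /= (big_pred1 (inord (f i))) // => j; rewrite eq_sym.
Qed.

Definition affine_simplex m n (f : nat -> nat) (t : std_simplex m) :
  std_simplex n := exist _ (affine_row n f (set_val t)) (affine_row_simplex n f t).

Fact affine_simplex_continuous m n f : continuous (@affine_simplex m n f).
Proof.
apply: continuous_comp_initial => t A [P nP PA]; rewrite /= in nP.
suff : \forall s \near t, forall i j, P i j (affine_row n f (set_val s) i j).
  by apply: filterS => s Ps; exact: PA.
apply: (@filter_forall _ _ (fun i s => forall j, P i j (affine_row n f (set_val s) i j)) (nbhs t) _) => i.
apply: (@filter_forall _ _ (fun j s => P i j (affine_row n f (set_val s) i j)) (nbhs t) _) => j.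
have /(_ t) sumc : continuous (fun s : std_simplex m =>
    \sum_(k < m.+1 | inord (f k) == j) set_val s 0 k).
  apply: (@continuous_big K _ +%R 0 _ (@add_continuous K)) => k _.
  move=> s; apply: (@continuous_comp _ _ _ (set_val : std_simplex m -> _)
    (fun M : 'rV[K]_m.+1 => M 0 k) s).
    exact: initial_continuous.
  exact: coord_continuous.
have : nbhs (\sum_(k < m.+1 | inord (f k) == j) set_val t 0 k) (P i j).
  by have := nP i j; rewrite mxE.
move/sumc => sumP; apply: (@filterS _ (nbhs t) _ _ _ _ sumP) => s /=; by rewrite mxE.
Qed.

Section sing.
Variable X : topologicalType.

Definition sing n := continuousType (std_simplex n) X.

(* Precomposition with the affine map Delta^m -> Delta^n given by f on vertices:
   bump i gives the i-th face, id the front face and addn p the back face. *)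
Definition sing_face m n (f : nat -> nat) (s : sing n) : sing m :=
  (s : continuousType _ _) \o mkcts (@affine_simplex_continuous m n f).

Lemma sing_face_eq m n f g (s : sing n) :
  (forall i, (i <= m)%N -> f i = g i) -> sing_face m f s = sing_face m g s.
Proof.
move=> fg; apply/continuousEP => t /=; congr (s _); apply: val_inj => /=.
apply/rowP => j; rewrite !mxE; apply: eq_bigl => i.
by rewrite fg // -ltnS.
Qed.

Lemma sing_face_comp m k n f g (s : sing n) :
  (forall i, (i <= m)%N -> (f i <= k)%N) ->
  sing_face m f (sing_face k g s) = sing_face m (g \o f) s.
Proof.
move=> fk; apply/continuousEP => t /=; congr (s _); apply: val_inj => /=.
apply/rowP => j; rewrite !mxE.
have fkE (i : 'I_m.+1) : (inord (f i) : 'I_k.+1) = f i :> nat.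
  by rewrite inordK // ltnS fk // -ltnS.
rewrite (partition_big (fun i : 'I_m.+1 => inord (f i) : 'I_k.+1)
  (fun l : 'I_k.+1 => inord (g l) == j)) /=; last by move=> i; rewrite fkE.
apply: eq_bigr => l lj; rewrite mxE; apply: eq_bigl => i.
case: eqVneq => [il|]; last by rewrite andbF.
by rewrite andbT -(eqP lj) -il fkE eqxx.
Qed.

Lemma sing_face_id n (s : sing n) : sing_face n id s = s.
Proof.
apply/continuousEP => t /=; congr (s _); apply: val_inj => /=.
apply/rowP => j; rewrite !mxE (big_pred1 j) // => i.
by rewrite inord_val.
Qed.

End sing.
End simplices.

Section cohomology_ring.
Variables (K : realType) (R : comPzRingType) (X : topologicalType).

Local Notation sing := (sing K X).

(* The direct sum over n of the singular cochain groups C^n(X; R): a family of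
   cochains, one in each degree, almost all zero. *)
Record cochain := MkCochain {
  cochain_fun :> forall n, sing n -> R;
  cochain_finite : exists N, forall n s, (N <= n)%N -> @cochain_fun n s = 0 }.

Lemma cochainP (a b : cochain) : (forall n s, a n s = b n s) <-> a = b.
Proof.
split=> [|-> //]; case: a b => [a fa] [b fb] /= ab.
have {}ab : a = b by apply: functional_extensionality_dep => n; apply/funext/ab.
by subst b; congr MkCochain; exact: Prop_irrelevance.
Qed.

HB.instance Definition _ := gen_eqMixin cochain.
HB.instance Definition _ := gen_choiceMixin cochain.

Program Definition cochain0 := @MkCochain (fun _ _ => 0) _.
Next Obligation. by exists 0%N. Qed.

Program Definition cochain1 := @MkCochain (fun n _ => (n == 0)%:R) _.
Next Obligation. by exists 1%N => -[]. Qed.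

Program Definition cochain_opp (a : cochain) := @MkCochain (fun n s => - a n s) _.
Next Obligation.
move=> a; have [N aN] := cochain_finite a.
by exists N => n s /aN ->; rewrite oppr0.
Qed.

Program Definition cochain_add (a b : cochain) :=
  @MkCochain (fun n s => a n s + b n s) _.
Next Obligation.
move=> a b; have [N aN] := cochain_finite a; have [M bM] := cochain_finite b.
exists (N + M)%N => n s NMn; rewrite aN ?bM ?addr0 //; lia.
Qed.

Program Definition cup (a b : cochain) := @MkCochain (fun n s =>
  \sum_(p < n.+1) a p (sing_face p id s) *
                  b (n - p)%N (sing_face (n - p) (addn p) s)) _.
Next Obligation.
move=> a b; have [N aN] := cochain_finite a; have [M bM] := cochain_finite b.
exists (N + M)%N => n s NMn; apply: big1 => p _.
have [Np|pN] := leqP N p; first by rewrite aN ?mul0r.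
by rewrite bM ?mulr0 //; lia.
Qed.

Fact cochain_addA : associative cochain_add.
Proof. by move=> a b c; apply/cochainP => n s /=; rewrite addrA. Qed.

Fact cochain_addC : commutative cochain_add.
Proof. by move=> a b; apply/cochainP => n s /=; rewrite addrC. Qed.

Fact cochain_add0 : left_id cochain0 cochain_add.
Proof. by move=> a; apply/cochainP => n s /=; rewrite add0r. Qed.

Fact cochain_addN : left_inverse cochain0 cochain_opp cochain_add.
Proof. by move=> a; apply/cochainP => n s /=; rewrite addNr. Qed.

Lemma sum_triangle (T : nat -> nat -> nat -> R) n :
  \sum_(m < n.+1) \sum_(p < m.+1) T p (m - p)%N (n - m)%N =
  \sum_(p < n.+1) \sum_(q < (n - p).+1) T p q (n - p - q)%N.
Proof.
transitivity (\sum_(m < n.+1) \sum_(p < n.+1 | (p <= m)%N) T p (m - p)%N (n - m)%N).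
  apply: eq_bigr => m _; rewrite (big_ord_widen n.+1 (fun p => T p (m - p)%N (n - m)%N)) //.
rewrite (exchange_big_dep predT) //=; apply: eq_bigr => p _.
rewrite -(big_mkord (fun m => (p <= m)%N) (fun m => T p (m - p)%N (n - m)%N)).
rewrite -(big_mkord predT (fun q => T p q (n - p - q)%N)).
rewrite -(big_nat_widenl p 0 n.+1 predT) // -{1}[nat_of_ord p]add0n big_addn.
rewrite subSn; last by rewrite -ltnS.
by apply: eq_bigr => i _; rewrite addnK; congr T; lia.
Qed.

Fact cupA : associative cup.
Proof.
move=> a b c; apply/cochainP => n s /=.
pose T p q r := a p (sing_face p id s) * b q (sing_face q (addn p) s) *
  c r (sing_face r (addn (p + q)) s).
transitivity (\sum_(p < n.+1) \sum_(q < (n - p).+1) T p q (n - p - q)%N).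
  apply: eq_bigr => p _; rewrite mulr_sumr; apply: eq_bigr => q _.
  rewrite mulrA /T; congr (_ * b q _ * c (n - p - q)%N _).
    by rewrite sing_face_comp // => i; move: (ltn_ord q); lia.
  rewrite sing_face_comp; last by move=> i; move: (ltn_ord q); lia.
  by apply: sing_face_eq => i _ /=; rewrite addnA.
rewrite -sum_triangle; apply: eq_bigr => m _; rewrite mulr_suml.
apply: eq_bigr => p _; rewrite /T; congr (a p _ * b (m - p)%N _ * c (n - m)%N _).
- by rewrite sing_face_comp // => i; move: (ltn_ord p); lia.
- by rewrite sing_face_comp // => i; move: (ltn_ord p); lia.
- by apply: sing_face_eq => i _; rewrite subnKC // -ltnS.
Qed.

Fact cup1l : left_id cochain1 cup.
Proof.
move=> a; apply/cochainP => n s /=; rewrite big_ord_recl /= big1 ?addr0; last first.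
  by move=> i _; rewrite mul0r.
rewrite mul1r subn0 (_ : sing_face _ _ _ = s) //.
rewrite -[RHS]sing_face_id; exact: sing_face_eq.
Qed.

Fact cup1r : right_id cochain1 cup.
Proof.
move=> a; apply/cochainP => n s /=; rewrite big_ord_recr /= big1 ?add0r; last first.
  by move=> i _; rewrite subn_eq0 leqNgt ltn_ord mulr0.
by rewrite subnn mulr1 sing_face_id.
Qed.

Fact cupDl : left_distributive cup cochain_add.
Proof.
move=> a b c; apply/cochainP => n s /=; rewrite -big_split.
by apply: eq_bigr => p _; rewrite mulrDl.
Qed.

Fact cupDr : right_distributive cup cochain_add.
Proof.
move=> a b c; apply/cochainP => n s /=; rewrite -big_split.
by apply: eq_bigr => p _; rewrite mulrDr.
Qed.

HB.instance Definition _ := GRing.isPzRing.Build cochain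
  cochain_addA cochain_addC cochain_add0 cochain_addN
  cupA cup1l cup1r cupDl cupDr.

Definition coboundary_fun (a : cochain) n : sing n -> R :=
  if n is m.+1 return sing n -> R then fun s =>
    \sum_(i < m.+2) (-1) ^+ i * a m (sing_face m (bump i) s)
  else fun=> 0.
Arguments coboundary_fun : simpl never.

Program Definition coboundary (a : cochain) := @MkCochain (coboundary_fun a) _.
Next Obligation.
move=> a; have [N aN] := cochain_finite a.
by exists N.+1 => -[//|n] s Nn; apply: big1 => i _; rewrite aN ?mulr0.
Qed.

Program Definition grading (a : cochain) : cochain :=
  @MkCochain (fun n s => (-1) ^+ n * a n s) _.
Next Obligation.
move=> a; have [N aN] := cochain_finite a.
by exists N => n s /aN ->; rewrite mulr0.
Qed.

Lemma coboundary_fun0 a s : @coboundary_fun a 0 s = 0. Proof. by []. Qed.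

Lemma coboundary_funS a n s : @coboundary_fun a n.+1 s =
  \sum_(i < n.+2) (-1) ^+ i * a n (sing_face n (bump i) s).
Proof. by []. Qed.

Lemma gradingK : involutive grading.
Proof. by move=> a; apply/cochainP => n s /=; rewrite mulrA -expr2 sqrr_sign mul1r. Qed.

Lemma coboundaryB : {morph coboundary : a b / a - b}.
Proof.
move=> a b; apply/cochainP => -[|n] s /=.
  by rewrite !coboundary_fun0 subr0.
rewrite !coboundary_funS -sumrB; apply: eq_bigr => i _; by rewrite mulrBr.
Qed.

Lemma coboundary_grading a : coboundary (grading a) = - grading (coboundary a).
Proof.
apply/cochainP => -[|n] s /=.
  by rewrite !coboundary_fun0 mulr0 oppr0.
rewrite !coboundary_funS mulr_sumr -sumrN; apply: eq_bigr => i _.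
by rewrite exprS mulN1r !mulNr opprK mulrCA.
Qed.

Lemma coboundaryM a b :
  coboundary (a * b) = coboundary a * b + grading a * coboundary b.
Proof.
apply/cochainP => -[|n] s /=.
  by rewrite !big_ord_recl !big_ord0 /= !coboundary_fun0 mul0r mulr0 !addr0.
rewrite coboundary_funS /=; under eq_bigr do rewrite mulr_sumr.
rewrite exchange_big /=.
rewrite [X in _ = X + _]big_ord_recl /= coboundary_fun0 mul0r add0r.
rewrite [X in _ = _ + X]big_ord_recr /= subnn coboundary_fun0.
rewrite mulr0 addr0 -big_split /=; apply: eq_bigr => p _.
have pn : (p <= n)%N by rewrite -ltnS.
set A := a p (sing_face p id s).
set B := b (n - p)%N (sing_face (n - p) (addn p.+1) s).
pose G i := (-1) ^+ i * (a p (sing_face p id (sing_face n (bump i) s)) *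
  b (n - p)%N (sing_face (n - p) (addn p) (sing_face n (bump i) s))).
transitivity (\sum_(i < p.+1) (-1) ^+ i * a p (sing_face p (bump i) s) * B +
  \sum_(i < (n - p).+1) (-1) ^+ (p.+1 + i) * A *
     b (n - p)%N (sing_face (n - p) (addn p \o bump i.+1) s)).
  have -> : \sum_(i < n.+2) G i = \sum_(i < p.+1 + (n - p).+1) G i.
    by rewrite -!(big_mkord predT); congr bigop; congr index_iota; lia.
  rewrite big_split_ord /=; congr (_ + _); apply: eq_bigr => i _; rewrite /G mulrA.
    rewrite sing_face_comp; last by move=> k /=; lia.
    congr (_ * b (n - p)%N _).
    rewrite sing_face_comp; last by move=> k; lia.
    by apply: sing_face_eq => k _ /=; rewrite /bump; move: (ltn_ord i); lia.
  rewrite sing_face_comp; last by move=> k; lia.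
  rewrite sing_face_comp; last by move=> k; lia.
  congr (_ * a p _ * b (n - p)%N _).
    by apply: sing_face_eq => k /=; rewrite /bump; lia.
  by apply: sing_face_eq => k /=; rewrite /bump; lia.
have -> : (n.+1 - p = (n - p).+1)%N by lia.
rewrite !coboundary_funS.
rewrite [in RHS]big_ord_recr /= mulrDl mulr_suml -addrA; congr (_ + _).
  apply: eq_bigr => i _; rewrite sing_face_comp // => k; rewrite /bump.
  by move: (ltn_ord i); lia.
rewrite [in RHS]big_ord_recl /= expr0 mul1r mulrDr addrA.
have -> : sing_face p (bump p.+1) (sing_face p.+1 id s) = sing_face p id s.
  rewrite sing_face_comp; last by move=> k; rewrite /bump; lia.
  by apply: sing_face_eq => k /=; rewrite /bump; lia.
have -> : sing_face (n - p) (bump 0) (sing_face (n - p).+1 (addn p) s) =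
    sing_face (n - p) (addn p.+1) s.
  rewrite sing_face_comp; last by move=> k; rewrite /bump; lia.
  by apply: sing_face_eq => k /=; rewrite /bump; lia.
rewrite -/A -/B exprS mulN1r !mulNr addNr add0r mulr_sumr.
apply: eq_bigr => i _; rewrite sing_face_comp; last first.
  by move=> k; rewrite /bump /=; lia.
rewrite -!mulrA [A * (_ * _)]mulrCA !mulrA -exprD; congr (_ ^+ _ * _ * b (n - p)%N _).
rewrite /bump /=; lia.
Qed.

(* Inhomogeneous cocycles; delta is taken degreewise. *)
Definition cocycle_pred : {pred cochain} := fun z => coboundary z == 0.

Fact cocycle_subring : subring_closed cocycle_pred.
Proof.
split=> [|a b /eqP za /eqP zb|a b /eqP za /eqP zb]; apply/eqP.
- apply/cochainP => -[|n] s //=; rewrite coboundary_funS /=.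
  case: n s => [|n] s /=; last by apply: big1 => i _; rewrite mulr0.
  by rewrite !big_ord_recl big_ord0 /= expr0 expr1 !mulr1 addr0 subrr.
- by rewrite coboundaryB za zb subrr.
- by rewrite coboundaryM za zb mul0r mulr0 addr0.
Qed.

HB.instance Definition _ := GRing.isSubringClosed.Build cochain cocycle_pred
  cocycle_subring.

Record cocycle := MkCocycle {
  cocycle_val :> cochain; _ : cocycle_val \in cocycle_pred }.

HB.instance Definition _ := [isSub for cocycle_val].
HB.instance Definition _ := [Choice of cocycle by <:].
HB.instance Definition _ := GRing.SubChoice_isSubPzRing.Build cochain cocycle_pred cocycle
  cocycle_subring.

Lemma cocycle0 (z : cocycle) : coboundary z = 0.
Proof. exact/eqP/(valP z). Qed.

Definition cohomologous : rel cocycle := fun z w =>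
  `[< exists b : cochain, \val z - \val w = coboundary b >].

Lemma cohomologousP z w :
  reflect (exists b : cochain, \val z - \val w = coboundary b) (cohomologous z w).
Proof. exact: asboolP. Qed.

Lemma coboundary_0 : coboundary 0 = 0.
Proof. by rewrite -[X in coboundary X](subrr 0) coboundaryB subrr. Qed.

Lemma coboundaryN : {morph coboundary : a / - a}.
Proof. by move=> a; rewrite -sub0r coboundaryB coboundary_0 sub0r. Qed.

Lemma coboundaryD : {morph coboundary : a b / a + b}.
Proof. by move=> a b; rewrite -[X in a + X]opprK coboundaryB coboundaryN opprK. Qed.

Fact cohomologous_equiv : equiv_class_of cohomologous.
Proof.
split=> [z|z w|y z w].
- by apply/cohomologousP; exists 0; rewrite subrr coboundary_0.
- by apply/cohomologousP/cohomologousP => -[b E]; exists (- b);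
    rewrite coboundaryN -E opprB.
- move=> /cohomologousP[b E] /cohomologousP[c F]; apply/cohomologousP.
  by exists (b + c); rewrite coboundaryD -E -F addrA subrK.
Qed.

Canonical cohomologous_equiv_rel := EquivRelPack cohomologous_equiv.

Local Open Scope quotient_scope.

(* H^*(X; R), the direct sum of all H^n(X; R), as a ring under cup product. *)
Definition cohomology := {eq_quot cohomologous}.

HB.instance Definition _ := Choice.on cohomology.
HB.instance Definition _ := EqQuotient.on cohomology.

Definition coh_class (z : cocycle) : cohomology := \pi_cohomology z.

Definition coh_opp (x : cohomology) : cohomology := coh_class (- repr x).
Definition coh_add (x y : cohomology) : cohomology := coh_class (repr x + repr y).
Definition coh_mul (x y : cohomology) : cohomology := coh_class (repr x * repr y).

Lemma pi_cohomology z w :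
  coh_class z = coh_class w <->
  exists b : cochain, \val z - \val w = coboundary b.
Proof. by rewrite /coh_class; split => [/eqmodP/cohomologousP|/cohomologousP E]//; apply/eqmodP. Qed.

Lemma repr_pi (z : cocycle) :
  exists b : cochain, \val (repr (coh_class z)) - \val z = coboundary b.
Proof. by apply/pi_cohomology; rewrite /coh_class reprK. Qed.

Lemma pi_opp z : coh_opp (coh_class z) = coh_class (- z).
Proof.
apply/pi_cohomology; have [b E] := repr_pi z; exists (- b).
by rewrite coboundaryN -E !raddfN /= opprB opprK addrC.
Qed.

Lemma pi_add z w : coh_add (coh_class z) (coh_class w) = coh_class (z + w).
Proof.
apply/pi_cohomology; have [b E] := repr_pi z; have [c F] := repr_pi w.
by exists (b + c); rewrite coboundaryD -E -F !raddfD /= addrACA.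
Qed.

Lemma pi_mul z w : coh_mul (coh_class z) (coh_class w) = coh_class (z * w).
Proof.
apply/pi_cohomology; have [b E] := repr_pi z; have [c F] := repr_pi w.
set z' := repr _ in E *; set w' := repr _ in F *.
exists (b * w' + grading z * c).
rewrite coboundaryD !coboundaryM cocycle0 mulr0 addr0.
rewrite coboundary_grading cocycle0 gradingK.
have -> : grading 0 = 0 by apply/cochainP => n s /=; rewrite mulr0.
rewrite oppr0 mul0r add0r -E -F !rmorphM /= mulrBl mulrBr.
by rewrite addrA subrK.
Qed.

Lemma coh_ind (P : cohomology -> Prop) :
  (forall z, P (coh_class z)) -> forall x, P x.
Proof. by move=> Pcl x; rewrite -[x]reprK; exact: Pcl. Qed.

Fact coh_addA : associative coh_add.
Proof.
elim/coh_ind => x; elim/coh_ind => y; elim/coh_ind => z.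
by rewrite !pi_add addrA.
Qed.

Fact coh_addC : commutative coh_add.
Proof. by elim/coh_ind => x; elim/coh_ind => y; rewrite !pi_add addrC. Qed.

Fact coh_add0 : left_id (coh_class 0) coh_add.
Proof. by elim/coh_ind => x; rewrite pi_add add0r. Qed.

Fact coh_addN : left_inverse (coh_class 0) coh_opp coh_add.
Proof. by elim/coh_ind => x; rewrite pi_opp pi_add addNr. Qed.

Fact coh_mulA : associative coh_mul.
Proof.
elim/coh_ind => x; elim/coh_ind => y; elim/coh_ind => z.
by rewrite !pi_mul mulrA.
Qed.

Fact coh_mul1l : left_id (coh_class 1) coh_mul.
Proof. by elim/coh_ind => x; rewrite pi_mul mul1r. Qed.

Fact coh_mul1r : right_id (coh_class 1) coh_mul.
Proof. by elim/coh_ind => x; rewrite pi_mul mulr1. Qed.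

Fact coh_mulDl : left_distributive coh_mul coh_add.
Proof.
elim/coh_ind => x; elim/coh_ind => y; elim/coh_ind => z.
by rewrite !(pi_add, pi_mul) mulrDl.
Qed.

Fact coh_mulDr : right_distributive coh_mul coh_add.
Proof.
elim/coh_ind => x; elim/coh_ind => y; elim/coh_ind => z.
by rewrite !(pi_add, pi_mul) mulrDr.
Qed.

HB.instance Definition _ := GRing.isPzRing.Build cohomology
  coh_addA coh_addC coh_add0 coh_addN
  coh_mulA coh_mul1l coh_mul1r coh_mulDl coh_mulDr.

(* The direct sum of the H^n(X; R) with n > 0. *)
Definition positive_degree : set cohomology :=
  [set x | exists z : cocycle, (forall s, \val z 0%N s = 0) /\ x = coh_class z].

End cohomology_ring.

Arguments coboundary_fun {K R X} a {n} s : simpl never.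

Section pullback.
Variables (K : realType) (R : comPzRingType) (X Y : topologicalType).
Variable f : continuousType X Y.

Program Definition cochain_pullback (a : cochain K R Y) : cochain K R X :=
  @MkCochain K R X (fun n (s : continuousType _ _) => a n (f \o s)) _.
Next Obligation.
by move=> a; have [N aN] := cochain_finite a; exists N => n s /aN ->.
Qed.

Fact cochain_pullback_cocycle (z : cocycle K R Y) :
  cochain_pullback z \in @cocycle_pred K R X.
Proof.
apply/eqP/cochainP => -[|n] s //=; rewrite coboundary_funS /=.
have /cochainP/(_ n.+1 (f \o (s : continuousType _ _))) := cocycle0 z.
rewrite /= coboundary_funS => zs; rewrite -[RHS]zs.
apply: eq_bigr => i _; congr (_ * (z : cochain _ _ _) n _).
exact/continuousEP.
Qed.

Definition cocycle_pullback (z : cocycle K R Y) : cocycle K R X :=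
  MkCocycle (cochain_pullback_cocycle z).

Definition cohomology_map (x : cohomology K R Y) : cohomology K R X :=
  coh_class (cocycle_pullback (repr x)).

Lemma cohomology_map_pi (z : cocycle K R Y) :
  cohomology_map (coh_class z) = coh_class (cocycle_pullback z).
Proof.
have [b /cochainP E] := repr_pi z.
apply/pi_cohomology; exists (cochain_pullback b); apply/cochainP => n s /=.
have /= -> := E n (f \o (s : continuousType _ _)).
case: n s {E} => [|n] s //; rewrite !coboundary_funS.
apply: eq_bigr => i _; congr (_ * (b : cochain _ _ _) n _).
exact/continuousEP.
Qed.

End pullback.

Section milnor.
Variables (K : realType) (G : topGroupType).

(* Milnor's model of EG, the infinite join of copies of G: a point is a formal
   sum t_0 g_0 + t_1 g_1 + ... with finitely many nonzero weights t_i >= 0 of sum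
   1, where g_i is recorded only when t_i <> 0. *)
Record milnor := MkMilnor {
  weight : nat -> K;
  label : nat -> option G;
  weight_ge0 : forall i, 0 <= weight i;
  weight_sum : exists N, (forall i, (N <= i)%N -> weight i = 0) /\
                         \sum_(i < N) weight i = 1;
  label_None : forall i, label i = None <-> weight i = 0 }.

HB.instance Definition _ := gen_eqMixin milnor.
HB.instance Definition _ := gen_choiceMixin milnor.

(* The coarsest topology making continuous each t_i : EG -> K and each
   g_i : {t_i <> 0} -> G, the domain of the latter being open. *)
Definition milnor_subbase : set (set milnor) :=
  [set A | exists i (V : set K), open V /\ A = [set e | V (weight e i)]] `|`
  [set A | exists i (V : set G), open V /\
             A = [set e | exists2 g, label e i = Some g & V g]].

HB.instance Definition _ :=
  isSubBaseTopological.Build milnor milnor_subbase id.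

Fact milnor_act_None (e : milnor) (g : G) i :
  omap (fun h => h * g)%g (label e i) = None <-> weight e i = 0.
Proof. by rewrite -label_None; case: (label e i). Qed.

(* G acts freely on the right of EG. *)
Definition milnor_act (e : milnor) (g : G) : milnor :=
  MkMilnor (weight_ge0 e) (weight_sum e) (milnor_act_None e g).

Lemma milnorP (e e' : milnor) :
  weight e = weight e' -> label e = label e' -> e = e'.
Proof.
case: e e' => [t l p q r] [t' l' p' q' r'] /= tt' ll'; subst t' l'.
by congr MkMilnor; exact: Prop_irrelevance.
Qed.

Lemma milnor_act1 e : milnor_act e 1%g = e.
Proof.
by apply: milnorP => //=; apply/funext => i; case: label => //= h; rewrite mulg1.
Qed.

Lemma milnor_actM e g h :
  milnor_act (milnor_act e g) h = milnor_act e (g * h)%g.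
Proof.
by apply: milnorP => //=; apply/funext => i; case: label => //= k; rewrite mulgA.
Qed.

Section borel.
Variable X : GSpace G.

(* The relation (e g, x) ~ (e, g x) defining EG x_G X. *)
Definition borel_rel : rel (milnor * X) := fun p q =>
  `[< exists g, p.1 = milnor_act q.1 g /\ q.2 = gact g p.2 >].

Fact borel_rel_equiv : equiv_class_of borel_rel.
Proof.
have sym p q : borel_rel p q -> borel_rel q p.
  move=> /asboolP[g [pq qp]]; apply/asboolP; exists g^-1%g; split.
    by rewrite pq milnor_actM mulgV milnor_act1.
  by rewrite qp -gactM mulVg gact1.
split=> [p|p q|q p r].
- by apply/asboolP; exists 1%g; rewrite milnor_act1 gact1.
- by apply/idP/idP => /sym.
- move=> /asboolP[g [pq qp]] /asboolP[h [qr rq]]; apply/asboolP.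
  by exists (h * g)%g; rewrite gactM pq qr rq qp milnor_actM.
Qed.

Canonical borel_equiv_rel := EquivRelPack borel_rel_equiv.

Local Open Scope quotient_scope.

Definition borel : topologicalType := quotient_topology {eq_quot borel_rel}.

Definition borel_class (p : milnor * X) : borel :=
  \pi_(quotient_topology {eq_quot borel_rel}) p.

Definition borel_repr (x : borel) : milnor * X :=
  repr (x : quotient_topology {eq_quot borel_rel}).

Lemma borel_reprK x : borel_class (borel_repr x) = x.
Proof. exact: reprK. Qed.

Lemma borel_classP p q :
  borel_class p = borel_class q <->
  exists g, p.1 = milnor_act q.1 g /\ q.2 = gact g p.2.
Proof.
split=> [pq|pq].
  apply/asboolP; apply/(@eqmodP _ borel_equiv_rel); exact: pq.
by apply/(@eqmodP _ borel_equiv_rel)/asboolP.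
Qed.

End borel.

Section borel_map.
Variables (X Y : GSpace G) (f : GMap X Y).

Definition borel_map_fun (x : borel X) : borel Y :=
  let p := borel_repr x in borel_class (p.1, f p.2).

Lemma borel_map_class p :
  borel_map_fun (borel_class p) = borel_class (p.1, f p.2).
Proof.
apply/borel_classP => /=.
have /borel_classP[g [-> pg]] := borel_reprK (borel_class p).
by exists g; rewrite pg gmapE.
Qed.

Fact borel_map_continuous : continuous borel_map_fun.
Proof.
apply/quotient_continuous.
pose idf (p : milnor * X) : milnor * Y := (p.1, f p.2).
have idfc : continuous idf.
  move=> p.
  have F1 : Filter (nbhs p) by exact: nbhs_filter.
  have F2 : Filter (nbhs p.1) by exact: nbhs_filter.
  have F3 : Filter (nbhs (f p.2)) by exact: nbhs_filter.
  refine (@cvg_pair _ _ _ (nbhs p) (nbhs p.1) (nbhs (f p.2)) _ _ _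
    (fun q => q.1) (fun q => f q.2) _ _); first exact: cvg_fst.
  apply: cvg_comp; first exact: cvg_snd.
  exact: cts_fun.
rewrite (_ : _ \o _ = @borel_class Y \o idf); last first.
  by apply/funext => p; exact: borel_map_class.
move=> p; apply: continuous_comp; first exact: idfc.
exact: pi_continuous.
Qed.

Definition borel_map : continuousType (borel X) (borel Y) :=
  mkcts borel_map_continuous.

End borel_map.
End milnor.

Section cup_length.

Definition nonzero_product (A : pzRingType) (S : set A) (k : nat) : Prop :=
  exists x : 'I_k -> A, (forall i, S (x i)) /\ \prod_(i < k) x i != 0.

Definition nil_length (A : pzRingType) (S : set A) : enat :=
  if pselect (forall x, S x -> x = 0) then Fin 0 else largest (nonzero_product S).

Variables (K : realType) (G : topGroupType) (R : comPzRingType).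

Definition H_G (X : GSpace G) : pzRingType := cohomology K R (borel K X).

Definition H_G_positive (X : GSpace G) : set (H_G X) :=
  @positive_degree K R (borel K X).

Definition H_G_map (X Y : GSpace G) (f : GMap X Y) : H_G Y -> H_G X :=
  cohomology_map (borel_map K f).

Definition cl_G (a : ob_mor G) : enat :=
  match a with
  | Ob X => nil_length (@H_G_positive X)
  | Mor X Y f => nil_length (H_G_map f @` @H_G_positive Y)
  end.

End cup_length.

(* Main.v *)
Require Import Defs.
From mathcomp Require Import all_boot all_order all_algebra.
From mathcomp Require Import all_classical all_reals all_analysis.

(* For cl_G, functoriality gives (h g f)^* = f^* g^* h^*; the map h^* preserves
   positive degree and the ring morphism f^* cannot turn a zero product into a
   nonzero one.  For cat_G, preimages under f of a cover adapted to g are adapted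
   to h g f, as a homotopy from the restriction of g into an orbit is
   precomposed with f and postcomposed with h. *)

Set Implicit Arguments.
Unset Strict Implicit.
Unset Printing Implicit Defensive.

Import Order.TTheory GRing.Theory.
Import numFieldNormedType.Exports.

Local Open Scope classical_set_scope.
Local Open Scope ring_scope.

(** * Extrema of predicates on the naturals, and lengths of nonzero products *)

(** Well-ordering of the naturals rules out the [Infty] branch as soon as [P] is inhabited. *)
Lemma least_Fin (P : nat -> Prop) n :
  P n -> exists m, [/\ least P = Fin m, P m & forall k, P k -> (m <= k)%N].
Proof.
move=> Pn; rewrite /least; case: pselect => [e|[]].
  by case: cid => m /= [Pm mP]; exists m.
have exP : exists k, `[< P k >] by exists n; exact/asboolP.
case: (ex_minnP exP) => m /asboolP Pm mP.
by exists m; split=> // k Pk; exact/mP/asboolP.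
Qed.

Lemma le_least (P Q : nat -> Prop) :
  (forall n, Q n -> P n) -> (least P <= least Q)%O.
Proof.
move=> QP; case: (pselect (exists n, Q n)) => [[n Qn]|nQ].
  have [q [-> Qq _]] := least_Fin Qn.
  by have [p [-> _]] := least_Fin (QP _ Qn); apply; exact: QP.
have -> : least Q = Infty.
  by rewrite /least; case: pselect => // e; case: nQ; case: e => m [Qm _]; exists m.
by case: (least P).
Qed.

(* Nonemptiness of P matters: [largest] of an empty predicate is Infty. *)
Lemma le_largest (P Q : nat -> Prop) n :
  P n -> (forall k, P k -> Q k) -> (largest P <= largest Q)%O.
Proof.
move=> Pn PQ; rewrite /largest; case: pselect => [eP|noP]; case: pselect => //.
  by move=> eQ; case: cid => p /= [Pp _]; case: cid => q /= [_ Qq]; exact/Qq/PQ.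
(* A maximum [q] of [Q] bounds the inhabited predicate [P], which then has a maximum too, against
   [noP]. *)
move=> eQ; case: noP; case: eQ => q [_ Qq].
have exP : exists k, `[< P k >] by exists n; exact/asboolP.
have Pq k : `[< P k >] -> (k <= q)%N by move=> /asboolP/PQ/Qq.
case: (ex_maxnP exP Pq) => m /asboolP Pm mP.
by exists m; split=> // k Pk; exact/mP/asboolP.
Qed.

Lemma nonzero_productS (A : pzRingType) (S T : set A) k :
  S `<=` T -> nonzero_product S k -> nonzero_product T k.
Proof. by move=> ST [x [Sx x0]]; exists x; split=> // i; exact: ST. Qed.

(** Products of length one detect nonzero elements. So the case [k = 1] of the hypothesis excludes
    the [Fin 0] branch for [T] when [S] has a nonzero element, and [S1] is the inhabitant that
    [le_largest] asks for. *)
Lemma le_nil_length (A B : pzRingType) (S : set A) (T : set B) :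
  (forall k, nonzero_product S k -> nonzero_product T k) ->
  (nil_length S <= nil_length T)%O.
Proof.
move=> ST; rewrite /nil_length; case: pselect => /= [_|S0].
  by case: pselect => /= _ //; case: (largest _).
have S1 : nonzero_product S 1.
  apply: contra_notP S0 => S1 x Sx; apply: contra_notP S1 => /eqP x0.
  by exists (fun=> x); split=> //; rewrite big_ord1.
case: pselect => /= [T0|_]; last exact: le_largest S1 ST.
have [x [Tx]] := ST _ S1.
by rewrite big_ord1 (T0 _ (Tx _)) eqxx.
Qed.

(** * Singular cohomology as a contravariant functor to rings *)

Section cohomology_functoriality.
Variables (K : realType) (R : comPzRingType).

Lemma cohomology_map1 (X Y : topologicalType) (f : continuousType X Y) :
  cohomology_map f (1 : cohomology K R Y) = 1.
Proof.
rewrite [LHS]cohomology_map_pi; congr coh_class; apply: val_inj.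
exact/cochainP.
Qed.

Lemma coh_classM (X : topologicalType) (z w : cocycle K R X) :
  coh_class (z * w) = coh_class z * coh_class w.
Proof. by symmetry; exact: Defs.pi_mul. Qed.

(** Multiplicativity holds already on cochains: taking faces precomposes a simplex and [f]
    postcomposes it, so the two commute. *)
Lemma cohomology_mapM (X Y : topologicalType) (f : continuousType X Y) :
  {morph @cohomology_map K R X Y f : x y / x * y}.
Proof.
elim/coh_ind => z; elim/coh_ind => w.
rewrite -coh_classM !cohomology_map_pi -coh_classM; congr coh_class.
apply: val_inj; apply/cochainP => n s /=; apply: eq_bigr => p _.
by congr ((z : cochain _ _ _) p _ * (w : cochain _ _ _) (n - p)%N _); exact/continuousEP.
Qed.

(** The third map [h] is only pointwise equal to the composite, because [borel_map] goes through
    chosen representatives and respects composition only up to a proof. *)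
Lemma cohomology_map_comp (X Y Z : topologicalType) (f : continuousType X Y)
    (g : continuousType Y Z) (h : continuousType X Z) :
  h =1 g \o f ->
  @cohomology_map K R X Z h =1 cohomology_map f \o cohomology_map g.
Proof.
move=> hgf; elim/coh_ind => z; rewrite /= !cohomology_map_pi; congr coh_class.
apply: val_inj; apply/cochainP => n s /=; congr ((z : cochain _ _ _) n _).
by apply/continuousEP => t; exact: hgf.
Qed.

Lemma cohomology_map_id (X : topologicalType) (f : continuousType X X) :
  f =1 id -> @cohomology_map K R X X f =1 id.
Proof.
move=> fid; elim/coh_ind => z; rewrite /= cohomology_map_pi; congr coh_class.
apply: val_inj; apply/cochainP => n s /=; congr ((z : cochain _ _ _) n _).
by apply/continuousEP => t; exact: fid.
Qed.

Lemma cohomology_map_positive (X Y : topologicalType) (f : continuousType X Y) x :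
  @positive_degree K R Y x -> positive_degree (cohomology_map f x).
Proof.
move=> [z [z0 ->]]; rewrite cohomology_map_pi.
by exists (cocycle_pullback f z); split=> // s; exact: z0.
Qed.

End cohomology_functoriality.

(** * Borel cohomology and cup length *)

Section borel_cohomology.
Variables (K : realType) (G : topGroupType) (R : comPzRingType).

Lemma borel_map_id (X : GSpace G) : borel_map K (gid X) =1 id.
Proof.
by move=> x; have := borel_reprK x; rewrite [borel_repr x]surjective_pairing; exact.
Qed.

(** By [borel_map_class], the map of [g] may be evaluated on the representative produced by [f]
    instead of the chosen one. *)
Lemma borel_map_comp (X Y Z : GSpace G) (g : GMap Y Z) (f : GMap X Y) :
  borel_map K (gcomp g f) =1 borel_map K g \o borel_map K f.
Proof. by move=> x; exact/esym/(borel_map_class g (_, _)). Qed.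

Lemma H_G_map_id (X : GSpace G) : @H_G_map K G R X X (gid X) =1 id.
Proof. exact/cohomology_map_id/borel_map_id. Qed.

Lemma H_G_map_comp (X Y Z : GSpace G) (g : GMap Y Z) (f : GMap X Y) :
  @H_G_map K G R X Z (gcomp g f) =1 @H_G_map K G R X Y f \o @H_G_map K G R Y Z g.
Proof. exact/cohomology_map_comp/borel_map_comp. Qed.

Lemma H_G_map_prod (X Y : GSpace G) (f : GMap X Y) k (x : 'I_k -> H_G K R Y) :
  @H_G_map K G R X Y f (\prod_i x i) = \prod_i H_G_map f (x i).
Proof.
apply: big_morph; [exact: cohomology_mapM|exact: cohomology_map1].
Qed.

Lemma H_G_map0 (X Y : GSpace G) (f : GMap X Y) : @H_G_map K G R X Y f 0 = 0.
Proof.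
rewrite /H_G_map [LHS]cohomology_map_pi; congr coh_class; apply: val_inj.
exact/cochainP.
Qed.

Lemma nonzero_product_H_G_map (X Y : GSpace G) (f : GMap X Y)
    (S : set (H_G K R Y)) k :
  nonzero_product (@H_G_map K G R X Y f @` S) k -> nonzero_product S k.
Proof.
move=> [x [Sx x0]]; have /choice[y yP] i : exists y, S y /\ H_G_map f y = x i.
  by have [y] := Sx i; exists y.
exists y; split=> [i|]; first exact: (yP i).1.
(* The given product is the image of the product of the lifts [y i], hence vanishes if the latter
   does. *)
apply: contra_neq x0 => y0; rewrite -(H_G_map0 f) -y0 H_G_map_prod.
by apply: eq_bigr => i _; rewrite (yP i).2.
Qed.

Lemma cl_G_invariant : is_G_categorical_invariant (@cl_G K G R).
Proof.
split=> [X|X Y Z W f g h] /=.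
  congr nil_length; rewrite -[RHS]image_id; apply: eq_imagel => x _.
  exact: H_G_map_id.
(* It suffices that every class in the image for the triple composite is [f^*] of some [g^* u] with
   [u = h^* x] of positive degree. *)
apply: le_nil_length => k np; apply: (@nonzero_product_H_G_map _ _ f).
apply: nonzero_productS np => _ [x x0 <-]; exists (H_G_map g (H_G_map h x)).
  by exists (H_G_map h x) => //; exact: cohomology_map_positive.
by rewrite !H_G_map_comp /= H_G_map_comp.
Qed.

End borel_cohomology.

(** * Orbit-contractibility and categorical covers *)

Section equivariant_category.
Variables (K : realType) (G : topGroupType).

(** A homotopy sees [f] only through its values at time 0, so the same witnesses serve [f']. *)
Lemma eq_G_orbit_contractible (X Y : GSpace G) (f f' : GMap X Y) :
  f =1 f' -> G_orbit_contractible K f -> G_orbit_contractible K f'.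
Proof.
move=> ff' [y [c [cy [H [HG H0 H1]]]]]; exists y, c; split=> //.
by exists H; split=> // x t t0; rewrite H0.
Qed.

Lemma G_orbit_contractible_postcomp (X Y Z : GSpace G) (h : GMap Y Z)
    (f : GMap X Y) :
  G_orbit_contractible K f -> G_orbit_contractible K (gcomp h f).
Proof.
move=> [y [c [cy [H [HG H0 H1]]]]]; exists (h y), (gcomp h c); split.
  (* Equivariance of [h] carries the orbit of [y] into that of [h y]. *)
  by move=> _ [x _ <-]; have [g _ gy] := cy _ (imageT c x);
     exists g => //=; rewrite -gmapE gy.
exists (h \o H); split=> [g x t|x t t0|x t t1] /=.
- by rewrite HG gmapE.
- by rewrite H0.
- by rewrite H1.
Qed.

Lemma G_orbit_contractible_precomp (X Y Z : GSpace G) (g : GMap Y Z)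
    (f : GMap X Y) :
  G_orbit_contractible K g -> G_orbit_contractible K (gcomp g f).
Proof.
move=> [z [c [cz [H [HG H0 H1]]]]]; exists z, (gcomp c f); split.
  by move=> _ [x _ <-]; apply: cz; exists (f x).
(* [F] is the product of [f] with the identity of the interval; [H \o F] is the new homotopy. *)
pose F (p : X * @unit_interval K) : Y * @unit_interval K := (f p.1, p.2).
have Fc : continuous F.
  move=> p; apply: (@cvg_pair _ _ _ (nbhs p) (nbhs (f p.1)) (nbhs p.2)).
    by apply: cvg_comp; [exact: cvg_fst|exact: cts_fun].
  exact: cvg_snd.
exists (H \o mkcts Fc); split=> [a x t|x t t0|x t t1] /=.
- transitivity (H (gact a (f x), t)); last exact: HG.
  by congr (H (_, t)); exact: gmapE.
- exact: H0.
- exact: H1.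
Qed.

Section restriction.
Variables (X Y : GSpace G) (f : GMap X Y) (V : set Y) (invV : G_invariant V).

Lemma G_invariant_preimage : G_invariant (f @^-1` V).
Proof. by move=> a x; rewrite /preimage /= gmapE; exact: invV. Qed.

Definition restrict_fun (x : f @^-1` V) : V :=
  exist _ (f (set_val x)) (mem_set (set_valP x : V (f (set_val x)))).

Lemma restrict_continuous : continuous restrict_fun.
Proof.
apply: continuous_comp_initial => x.
apply: (@continuous_comp _ _ _ (set_val : f @^-1` V -> X) f).
  exact: initial_continuous.
exact: cts_fun.
Qed.

Lemma restrict_equivariant a (x : sub_GSpace G_invariant_preimage) :
  restrict_fun (gact a x) = gact a (restrict_fun x : sub_GSpace invV).
Proof. by apply: val_inj; exact: gmapE. Qed.

(** It lets [f] restricted to the preimage of [V] factor through the inclusion of [V], where a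
    contraction of [g] is available. *)
Definition restrict : GMap (sub_GSpace G_invariant_preimage) (sub_GSpace invV) :=
  @MkGMap G (sub_GSpace G_invariant_preimage) (sub_GSpace invV)
    (mkcts restrict_continuous) restrict_equivariant.

End restriction.

Lemma cat_cover_mor_comp (X Y Z W : GSpace G) (f : GMap X Y) (g : GMap Y Z)
    (h : GMap Z W) n :
  cat_cover_mor K g n -> cat_cover_mor K (gcomp h (gcomp g f)) n.
Proof.
move=> [V [invV [oV cV ctV]]].
exists (fun i => f @^-1` V i), (fun i => G_invariant_preimage (f := f) (invV i)).
split=> [i||i].
- by apply: open_comp => // x _; exact: cts_fun.
- by rewrite -preimage_bigcup cV preimage_setT.
(* Both maps send [x] to [h (g (f x))]; the one supplied passes through [V i], so that [ctV i]
   applies to its middle factor. *)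
- apply: (eq_G_orbit_contractible
    (f := gcomp h (gcomp (gcomp g (Defs.incl (invV i))) (restrict f (invV i))))) => //.
  exact/G_orbit_contractible_postcomp/G_orbit_contractible_precomp.
Qed.

Lemma cat_cover_mor_id (X : GSpace G) n :
  cat_cover_mor K (gid X) n <-> cat_cover_ob K X n.
Proof.
by split=> -[U [invU [oU cU ctU]]]; exists U, invU; split=> // i;
  apply: eq_G_orbit_contractible (ctU i).
Qed.

Lemma cat_G_invariant : is_G_categorical_invariant (@cat_G K G).
Proof.
split=> [X|X Y Z W f g h] /=.
  by congr least; apply/funext => n; apply/propext; exact: cat_cover_mor_id.
by apply: le_least => n; exact: cat_cover_mor_comp.
Qed.

End equivariant_category.

Theorem proposition3p7 (K : realType) (G : topGroupType) (R : comPzRingType) :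
  is_G_categorical_invariant (@cl_G K G R) /\
  is_G_categorical_invariant (@cat_G K G).
Proof. by split; [exact: cl_G_invariant|exact: cat_G_invariant]. Qed.
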